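(* Let $A$ be a ring such that the inclusion functor $e_* : \mathsf{E}(A) \to \mathsf{K}(\mathsf{Pro}\,A)$ has a right adjoint. Let $M$ be a left $A$-module. Then there is a Gorenstein projective precover $G \to M$ whose kernel $Z$ satisfies that each projective resolution of $Z$ is also a Gorenstein projective resolution of $Z$.
   Context: Complexes are written cohomologically and may be unbounded. $\mathsf{K}(\mathsf{Pro}\,A)$ is the homotopy category of complexes of projective left $A$-modules. $\mathsf{E}(A)$ is the class of complexes $E$ of left $A$-modules such that $E$ consists of projective modules, $E$ is exact, and $\operatorname{Hom}_A(E,Q)$ is exact for each projective left $A$-module $Q$. It is viewed as a full subcategory of $\mathsf{K}(\mathsf{Pro}\,A)$, with inclusion functor $e_*$. A left $A$-module is Gorenstein projective if it has the form $\operatorname{Ker}(E^1 \to E^2)$ for some $E$ in $\mathsf{E}(A)$. A homomorphism $X \xrightarrow{s} Y$ is a relative epimorphism with respect to the class of Gorenstein projective modules if each homomorphism $G' \to Y$ with $G'$ Gorenstein projective factors through $s$. A Gorenstein projective precover of $M$ is a homomorphism $G \to M$ which is a relative epimorphism with respect to the class of Gorenstein projective modules, with $G$ Gorenstein projective. An augmented Gorenstein projective resolution of a module $Z$ is an exact sequence $\cdots \to G^{-1} \to G^0 \to Z \to 0$ in which each $G^{j}$ is Gorenstein projective and such that, when the sequence is split up into short exact sequences, the surjection in each of these is a relative epimorphism with respect to the class of Gorenstein projective modules; the complex $\cdots \to G^{-1} \to G^0 \to 0 \to \cdots$ is then called a Gorenstein projective resolution of $Z$ (some authors say ''proper''). 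*)

(* Defs.v *)
From HB Require Import structures.
From Corelib Require Import RelationClasses.
From mathcomp Require Import all_boot all_algebra.

Set Implicit Arguments.
Unset Strict Implicit.
Unset Printing Implicit Defensive.

Import GRing.Theory.
Local Open Scope ring_scope.

(* Categories whose hom-sets are presented as setoids: a morphism is a class
   of elements of [hom x y] modulo [heq]. *)

Record category := Category {
  obj : Type;
  hom : obj -> obj -> Type;
  heq : forall x y, hom x y -> hom x y -> Prop;
  idm : forall x, hom x x;
  hcomp : forall x y z, hom y z -> hom x y -> hom x z;
  heq_equiv : forall x y, Equivalence (@heq x y);
  hcomp_heq : forall x y z (g g' : hom y z) (f f' : hom x y),
    heq g g' -> heq f f' -> heq (hcomp g f) (hcomp g' f');
  hcomp_idl : forall x y (f : hom x y), heq (hcomp (idm y) f) f;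
  hcomp_idr : forall x y (f : hom x y), heq (hcomp f (idm x)) f;
  hcompA : forall x y z t (h : hom z t) (g : hom y z) (f : hom x y),
    heq (hcomp h (hcomp g f)) (hcomp (hcomp h g) f)
}.

Record functor (C D : category) := Functor {
  fobj : obj C -> obj D;
  fmap : forall x y, hom x y -> hom (fobj x) (fobj y);
  fmap_heq : forall x y (f g : hom x y), heq f g -> heq (fmap f) (fmap g);
  fmap_id : forall x, heq (fmap (idm x)) (idm (fobj x));
  fmap_comp : forall x y z (g : hom y z) (f : hom x y),
    heq (fmap (hcomp g f)) (hcomp (fmap g) (fmap f))
}.

Record adjunction (C D : category) (F : functor C D) (G : functor D C) :=
  Adjunction {
  adj_r : forall (x : obj C) (y : obj D), hom (fobj F x) y -> hom x (fobj G y);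
  adj_l : forall (x : obj C) (y : obj D), hom x (fobj G y) -> hom (fobj F x) y;
  adj_r_heq : forall x y (f g : hom (fobj F x) y),
    heq f g -> heq (adj_r f) (adj_r g);
  adj_l_heq : forall x y (f g : hom x (fobj G y)),
    heq f g -> heq (adj_l f) (adj_l g);
  adj_rK : forall x y (f : hom (fobj F x) y), heq (adj_l (adj_r f)) f;
  adj_lK : forall x y (f : hom x (fobj G y)), heq (adj_r (adj_l f)) f;
  adj_natural : forall x x' y y' (k : hom x' x) (h : hom y y')
      (f : hom (fobj F x) y),
    heq (adj_r (hcomp h (hcomp f (fmap F k))))
        (hcomp (fmap G h) (hcomp (adj_r f) k))
}.

Definition has_right_adjoint (C D : category) (F : functor C D) : Prop :=
  exists G : functor D C, inhabited (adjunction F G).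

Definition full_subcategory (C : category) (P : obj C -> Prop) : category :=
  @Category {x : obj C | P x}
    (fun x y => hom (sval x) (sval y))
    (fun x y => @heq C (sval x) (sval y))
    (fun x => idm (sval x))
    (fun x y z => @hcomp C (sval x) (sval y) (sval z))
    (fun x y => heq_equiv (sval x) (sval y))
    (fun x y z => @hcomp_heq C (sval x) (sval y) (sval z))
    (fun x y => @hcomp_idl C (sval x) (sval y))
    (fun x y => @hcomp_idr C (sval x) (sval y))
    (fun x y z t => @hcompA C (sval x) (sval y) (sval z) (sval t)).

Definition inclusion (C : category) (P : obj C -> Prop) :
  functor (full_subcategory P) C.
Proof.
refine (@Functor (full_subcategory P) C sval (fun x y f => f) _ _ _).
- by [].
- by move=> x; have [r _ _] := heq_equiv (sval x) (sval x); apply: r.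
- move=> x y z g f.
  by have [r _ _] := heq_equiv (sval x) (sval z); apply: r.
Defined.

Definition surjective (X Y : Type) (f : X -> Y) : Prop :=
  forall y, exists x, f x = y.

Definition projective (A : pzRingType) (P : lmodType A) : Prop :=
  forall (X Y : lmodType A) (g : {linear X -> Y}) (f : {linear P -> Y}),
    surjective g -> exists h : {linear P -> X}, g \o h =1 f.

Definition exact_at (A : pzRingType) (X Y Z : lmodType A)
    (f : {linear X -> Y}) (g : {linear Y -> Z}) : Prop :=
  forall y, g y = 0 <-> exists x, f x = y.

Definition is_kernel (A : pzRingType) (K X Y : lmodType A)
    (k : {linear K -> X}) (f : {linear X -> Y}) : Prop :=
  injective k /\ exact_at k f.

(* The successor on [int], by cases so that it computes on constructors. *)
Definition succz (i : int) : int :=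
  match i with
  | Posz n => Posz n.+1
  | Negz 0 => Posz 0
  | Negz n.+1 => Negz n
  end.

Lemma succzE i : succz i = i + 1.
Proof.
case: i => [n|[|n]] //=; first by rewrite -addn1 PoszD.
by rewrite !NegzE -[n.+2]addn1 PoszD opprD addrNK.
Qed.

Lemma succz_pred i : succz (i - 1) = i.
Proof. by rewrite succzE subrK. Qed.

(* Cochain complexes, indexed by all of [int]. As [succz] is onto, a condition
   about degree [succz i] for every [i] is a condition about every degree. *)
Record complex (A : pzRingType) := Complex {
  cob :> int -> lmodType A;
  cd : forall i, {linear cob i -> cob (succz i)};
  cdd : forall i x, cd (succz i) (cd i x) = 0
}.

Record chain_map (A : pzRingType) (X Y : complex A) := ChainMap {
  cmap :> forall i, {linear X i -> Y i};
  cmapd : forall i x, cmap (succz i) (cd X i x) = cd Y i (cmap i x)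
}.

(* [s i] is the component [X^(i+1) -> Y^i] of the homotopy. *)
Definition homotopic (A : pzRingType) (X Y : complex A)
    (f g : chain_map X Y) : Prop :=
  exists s : forall i, {linear X (succz i) -> Y i},
    forall i x, f (succz i) x - g (succz i) x =
      cd Y i (s i x) + s (succz i) (cd X (succz i) x).

Definition chain_id (A : pzRingType) (X : complex A) : chain_map X X :=
  @ChainMap A X X (fun i => idfun) (fun i x => erefl).

Lemma chain_comp_subproof (A : pzRingType) (X Y Z : complex A)
    (g : chain_map Y Z) (f : chain_map X Y) i x :
  (g (succz i) \o f (succz i)) (cd X i x) = cd Z i ((g i \o f i) x).
Proof. by rewrite /= !cmapd. Qed.

Definition chain_comp (A : pzRingType) (X Y Z : complex A)
    (g : chain_map Y Z) (f : chain_map X Y) : chain_map X Z :=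
  @ChainMap A X Z (fun i => g i \o f i) (chain_comp_subproof g f).

Lemma homotopic_eq (A : pzRingType) (X Y : complex A) (f g : chain_map X Y) :
  (forall i, f i =1 g i) -> homotopic f g.
Proof.
by move=> fg; exists (fun i => \0) => i x; rewrite fg subrr /= raddf0 addr0.
Qed.

Lemma homotopic_equiv (A : pzRingType) (X Y : complex A) :
  Equivalence (@homotopic A X Y).
Proof.
split=> [f|f g [s sP]|f g h [s sP] [t tP]].
- exact: homotopic_eq.
- exists (fun i => \- (s i)) => i x.
  by rewrite -opprB sP /= raddfN -opprD.
- exists (fun i => s i \+ t i) => i x.
  by rewrite -(subrKA (g (succz i) x)) sP tP /= raddfD addrACA.
Qed.

Lemma homotopic_comp (A : pzRingType) (X Y Z : complex A)
    (g g' : chain_map Y Z) (f f' : chain_map X Y) :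
  homotopic g g' -> homotopic f f' ->
  homotopic (chain_comp g f) (chain_comp g' f').
Proof.
move=> [s sP] [t tP].
exists (fun i => (g i \o t i) \+ (s i \o f' (succz i))) => i x /=.
rewrite -(subrKA (g (succz i) (f' (succz i) x))) -raddfB tP sP.
by rewrite !raddfD /= -!cmapd addrACA.
Qed.

Definition homotopy_category (A : pzRingType) : category :=
  @Category (complex A) (@chain_map A) (@homotopic A) (@chain_id A)
    (@chain_comp A) (@homotopic_equiv A) (@homotopic_comp A)
    (fun X Y f => homotopic_eq (fun i x => erefl))
    (fun X Y f => homotopic_eq (fun i x => erefl))
    (fun X Y Z T h g f => homotopic_eq (fun i x => erefl)).

Definition projective_terms (A : pzRingType) (X : complex A) : Prop :=
  forall i, projective (X i).

Definition K_Pro (A : pzRingType) : category :=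
  @full_subcategory (homotopy_category A) (@projective_terms A).

Definition exact_complex (A : pzRingType) (X : complex A) : Prop :=
  forall i, exact_at (cd X i) (cd X (succz i)).

(* Exactness of [Hom_A(X, Q)] at each [Hom_A(X^(i+1), Q)]. *)
Definition Hom_exact (A : pzRingType) (X : complex A) (Q : lmodType A) : Prop :=
  forall i (f : {linear X (succz i) -> Q}),
    f \o cd X i =1 \0 <->
    exists g : {linear X (succz (succz i)) -> Q}, g \o cd X (succz i) =1 f.

Definition in_E (A : pzRingType) (X : complex A) : Prop :=
  [/\ projective_terms X, exact_complex X
    & forall Q : lmodType A, projective Q -> Hom_exact X Q].

Definition E_cat (A : pzRingType) : category :=
  @full_subcategory (K_Pro A) (fun X => in_E (sval X)).

Definition e_star (A : pzRingType) : functor (E_cat A) (K_Pro A) :=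
  @inclusion (K_Pro A) (fun X => in_E (sval X)).

Definition gorenstein_projective (A : pzRingType) (G : lmodType A) : Prop :=
  exists2 E : complex A, in_E E &
    exists k : {linear G -> E 1}, is_kernel k (cd E 1).

Definition gp_relative_epi (A : pzRingType) (X Y : lmodType A)
    (s : {linear X -> Y}) : Prop :=
  forall (G' : lmodType A) (f : {linear G' -> Y}),
    gorenstein_projective G' -> exists h : {linear G' -> X}, s \o h =1 f.

Definition gp_precover (A : pzRingType) (G M : lmodType A)
    (g : {linear G -> M}) : Prop :=
  gorenstein_projective G /\ gp_relative_epi g.

(* Exact sequences [... -> R^(-1) -> R^0 -> Z -> 0]; [rob n] is the term of
   cohomological degree [-n]. *)
Record augmented_resolution (A : pzRingType) (Z : lmodType A) :=
  AugmentedResolution {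
  rob :> nat -> lmodType A;
  rd : forall n, {linear rob n.+1 -> rob n};
  raug : {linear rob 0 -> Z};
  raug_surj : surjective raug;
  raug_exact : exact_at (rd 0) raug;
  rd_exact : forall n, exact_at (rd n.+1) (rd n)
}.

Definition projective_resolution (A : pzRingType) (Z : lmodType A)
    (R : augmented_resolution Z) : Prop :=
  forall n, projective (R n).

(* The surjection of [X] onto the image of [f] is a relative epimorphism; the
   image is given by an epi-mono factorization, unique up to isomorphism. *)
Definition gp_relative_epi_onto_image (A : pzRingType) (X Y : lmodType A)
    (f : {linear X -> Y}) : Prop :=
  exists (K : lmodType A) (s : {linear X -> K}) (k : {linear K -> Y}),
    [/\ surjective s, injective k, k \o s =1 f & gp_relative_epi s].

Definition gp_resolution (A : pzRingType) (Z : lmodType A)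
    (R : augmented_resolution Z) : Prop :=
  [/\ forall n, gorenstein_projective (R n),
      gp_relative_epi (raug R)
    & forall n, gp_relative_epi_onto_image (rd R n)].

(* Main.v *)
(** Let P be a projective resolution of M and eps : E -> P the counit of the
    adjunction, so that composition with eps is a bijection Hom(X, E) ->
    Hom(X, P) in the homotopy category for every X in E(A).  Take
    G = Z^1(E) (+) P^0, mapping to M by the map that eps induces on
    Z^1(E) = E^0 / B^0(E) and by the augmentation.  A map Z^1(X) -> M lifts to
    a chain map X -> P; surjectivity of eps_* lifts it further to E up to a
    homotopy, whose effect on Z^1(X) factors through P^0 -> M, so G -> M is a
    precover.  For the kernel Z, a map Z^1(X) -> Z gives a chain map X -> E
    that becomes null-homotopic in P; injectivity of eps_* makes it
    null-homotopic, and the homotopy extends the map Z^1(X) -> G to X^1.  By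
    the precover property, applied to Z^2(X) = X^1 / Z^1(X), the extension can
    be corrected to take values in Z.  Thus Ext^1 from Gorenstein projective
    modules to Z vanishes; the same correction argument passes this to all
    syzygies of Z, and it makes every surjection onto them a relative
    epimorphism. *)

From HB Require Import structures.
Require Import Defs.
From mathcomp Require Import all_boot all_algebra finmap.
From mathcomp.classical Require Import boolp.

Set Implicit Arguments.
Unset Strict Implicit.
Unset Printing Implicit Defensive.

Import GRing.Theory.
Local Open Scope ring_scope.

(** * Factoring linear maps, and kernels as modules *)

Lemma linear_of (A : pzRingType) (X Y : lmodType A) (f : X -> Y) :
  linear f -> exists g : {linear X -> Y}, g =1 f.
Proof.
move=> lin_f; pose m := GRing.isLinear.Build A X Y _ f lin_f.
pose g : {linear X -> Y} := HB.pack f m.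
by exists g.
Qed.

Lemma factor_injective (A : pzRingType) (X Y Z : lmodType A)
    (k : {linear Y -> Z}) (f : {linear X -> Z}) :
  injective k -> (forall x, exists y, k y = f x) ->
  exists h : {linear X -> Y}, forall x, k (h x) = f x.
Proof.
move=> k_inj ex.
have /choice[h hP] : forall x, exists y, k y = f x by [].
have lin_h : linear h.
  by move=> a u v; apply: k_inj; rewrite hP !linearP !hP.
by have [g gh] := linear_of lin_h; exists g => x; rewrite gh hP.
Qed.

(** The chosen section of [p] need not be linear; [f \o s] is, because [f] is constant on the fibres
    of [p]. *)
Lemma factor_surjective (A : pzRingType) (X Y Z : lmodType A)
    (p : {linear X -> Y}) (f : {linear X -> Z}) :
  surjective p -> (forall x, p x = 0 -> f x = 0) ->
  exists h : {linear Y -> Z}, forall x, h (p x) = f x.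
Proof.
move=> p_surj kerP.
have /choice[s sP] : forall y, exists x, p x = y by [].
have fE x x' : p x = p x' -> f x = f x'.
  move=> e; apply/eqP; rewrite -subr_eq0 -linearB; apply/eqP/kerP.
  by rewrite linearB e subrr.
have lin_h : linear (f \o s).
  by move=> a u v /=; rewrite -linearP; apply: fE; rewrite linearP !sP.
have [g gh] := linear_of lin_h.
by exists g => x; rewrite gh /=; apply: fE; rewrite sP.
Qed.

Definition in_kernel (A : pzRingType) (X Y : lmodType A)
  (f : {linear X -> Y}) : pred X := fun x => f x == 0.

Lemma in_kernel_submod (A : pzRingType) (X Y : lmodType A)
  (f : {linear X -> Y}) : submod_closed (in_kernel f).
Proof.
split; first by rewrite unfold_in /in_kernel linear0.
move=> a u v; rewrite !unfold_in /in_kernel => /eqP u0 /eqP v0.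
by rewrite linearP u0 v0 scaler0 addr0.
Qed.

HB.instance Definition _ (A : pzRingType) (X Y : lmodType A)
  (f : {linear X -> Y}) :=
  GRing.isSubmodClosed.Build A X (in_kernel f) (in_kernel_submod f).

Record ker (A : pzRingType) (X Y : lmodType A) (f : {linear X -> Y}) :=
  Ker { ker_val :> X; _ : in_kernel f ker_val }.

HB.instance Definition _ (A : pzRingType) (X Y : lmodType A)
  (f : {linear X -> Y}) := [isSub for @ker_val A X Y f].
HB.instance Definition _ (A : pzRingType) (X Y : lmodType A)
  (f : {linear X -> Y}) := [Choice of ker f by <:].
HB.instance Definition _ (A : pzRingType) (X Y : lmodType A)
  (f : {linear X -> Y}) := [SubChoice_isSubLmodule of ker f by <:].

Definition ker_incl (A : pzRingType) (X Y : lmodType A)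
  (f : {linear X -> Y}) : {linear ker f -> X} := val.

Arguments ker_incl : simpl never.

Lemma ker_inclP (A : pzRingType) (X Y : lmodType A) (f : {linear X -> Y}) :
  is_kernel (ker_incl f) f.
Proof.
split=> [|x]; first exact: val_inj.
split=> [/eqP fx0|[[y fy0] <-]]; first by exists (Ker fx0).
exact/eqP.
Qed.

(** * Free modules and their projectivity *)

Definition free_add (A : pzRingType) (T : choiceType)
    (f g : {fsfun T -> A with 0}) : {fsfun T -> A with 0} :=
  [fsfun x in (finsupp f `|` finsupp g)%fset => f x + g x].

Definition free_scale (A : pzRingType) (T : choiceType) (a : A)
    (f : {fsfun T -> A with 0}) : {fsfun T -> A with 0} :=
  [fsfun x in finsupp f => a * f x].

Lemma free_addE (A : pzRingType) (T : choiceType)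
  (f g : {fsfun T -> A with 0}) x : free_add f g x = f x + g x.
Proof.
rewrite fsfunE; case: ifPn => //; rewrite in_fsetU => /norP[].
by move=> /fsfun_dflt -> /fsfun_dflt ->; rewrite addr0.
Qed.

Lemma free_scaleE (A : pzRingType) (T : choiceType) a
  (f : {fsfun T -> A with 0}) x : free_scale a f x = a * f x.
Proof.
by rewrite fsfunE; case: ifPn => // /fsfun_dflt ->; rewrite mulr0.
Qed.

Definition free_mod (A : pzRingType) (T : choiceType) : Type :=
  {fsfun T -> A with 0}.

HB.instance Definition _ (A : pzRingType) (T : choiceType) :=
  Choice.copy (free_mod A T) {fsfun T -> A with 0}.

Lemma free_addA (A : pzRingType) (T : choiceType) :
  associative (@free_add A T).
Proof. by move=> f g h; apply/fsfunP => x; rewrite !free_addE addrA. Qed.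

Lemma free_addC (A : pzRingType) (T : choiceType) :
  commutative (@free_add A T).
Proof. by move=> f g; apply/fsfunP => x; rewrite !free_addE addrC. Qed.

Lemma free_add0 (A : pzRingType) (T : choiceType) :
  left_id ([fsfun] : {fsfun T -> A with 0}) (@free_add A T).
Proof. by move=> f; apply/fsfunP => x; rewrite free_addE fsfunE add0r. Qed.

Lemma free_addN (A : pzRingType) (T : choiceType) :
  left_inverse ([fsfun] : {fsfun T -> A with 0}) (free_scale (-1))
    (@free_add A T).
Proof.
move=> f; apply/fsfunP => x.
by rewrite free_addE free_scaleE fsfunE mulN1r addNr.
Qed.

HB.instance Definition _ (A : pzRingType) (T : choiceType) :=
  GRing.isZmodule.Build (free_mod A T) (@free_addA A T) (@free_addC A T)
    (@free_add0 A T) (@free_addN A T).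

Lemma free_scaleA (A : pzRingType) (T : choiceType) (a b : A)
  (f : free_mod A T) : free_scale a (free_scale b f) = free_scale (a * b) f.
Proof. by apply/fsfunP => x; rewrite !free_scaleE mulrA. Qed.

Lemma free_scale1 (A : pzRingType) (T : choiceType) :
  left_id 1 (@free_scale A T).
Proof. by move=> f; apply/fsfunP => x; rewrite free_scaleE mul1r. Qed.

Lemma free_scaleDr (A : pzRingType) (T : choiceType) :
  right_distributive (@free_scale A T) (@free_add A T).
Proof.
move=> a f g; apply/fsfunP => x.
by rewrite free_addE !free_scaleE free_addE mulrDr.
Qed.

Lemma free_scaleDl (A : pzRingType) (T : choiceType) (f : free_mod A T) :
  {morph (@free_scale A T)^~ f : a b / a + b >-> free_add a b}.
Proof.
by move=> a b; apply/fsfunP => x; rewrite free_addE !free_scaleE mulrDl.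
Qed.

HB.instance Definition _ (A : pzRingType) (T : choiceType) :=
  GRing.Zmodule_isLmodule.Build A (free_mod A T) (@free_scaleA A T)
    (@free_scale1 A T) (@free_scaleDr A T) (@free_scaleDl A T).

Definition supp (A : pzRingType) (T : choiceType) (f : free_mod A T) :
  {fset T} := finsupp (f : {fsfun T -> A with 0}).

Definition coeff (A : pzRingType) (T : choiceType) (f : free_mod A T) (x : T) :
  A := (f : {fsfun T -> A with 0}) x.

Lemma coeffP (A : pzRingType) (T : choiceType) a (f g : free_mod A T) x :
  coeff (a *: f + g) x = a * coeff f x + coeff g x.
Proof. by rewrite /coeff free_addE free_scaleE. Qed.

Definition free_lift_fun (A : pzRingType) (T : choiceType) (X : lmodType A)
    (b : T -> X) (f : free_mod A T) : X :=
  \sum_(x <- supp f) coeff f x *: b x.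

(** Padding the support lets the three sums in the linearity proof range over one common set. *)
Lemma free_lift_widen (A : pzRingType) (T : choiceType) (X : lmodType A)
    (b : T -> X) (f : free_mod A T) (S : {fset T}) :
  (supp f `<=` S)%fset ->
  free_lift_fun b f = \sum_(x <- S) coeff f x *: b x.
Proof.
move=> fS; apply: big_fset_incl => // x _ /fsfun_dflt fx0.
by rewrite /coeff fx0 scale0r.
Qed.

Lemma free_lift_linear (A : pzRingType) (T : choiceType) (X : lmodType A)
  (b : T -> X) : linear (free_lift_fun b).
Proof.
move=> a f g.
pose S := (supp (a *: f + g)%R `|` supp f `|` supp g)%fset.
rewrite !(@free_lift_widen _ _ _ b _ S); last first.
- by rewrite /S -fsetUA fsubsetUl.
- by rewrite /S fsetUAC fsubsetUr.
- exact: fsubsetUr.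
rewrite scaler_sumr -big_split /=; apply: eq_bigr => x _.
by rewrite coeffP scalerDl scalerA.
Qed.

HB.instance Definition _ (A : pzRingType) (T : choiceType) (X : lmodType A)
    (b : T -> X) :=
  GRing.isLinear.Build A (free_mod A T) X _ (free_lift_fun b)
    (free_lift_linear b).

Definition free_lift (A : pzRingType) (T : choiceType) (X : lmodType A)
  (b : T -> X) : {linear free_mod A T -> X} := free_lift_fun b.

Definition free_gen (A : pzRingType) (T : choiceType) (t : T) : free_mod A T :=
  [fsfun x in [fset t]%fset => 1].

Arguments free_lift : simpl never.

Lemma free_lift_gen (A : pzRingType) (T : choiceType) (X : lmodType A)
  (b : T -> X) (t : T) : free_lift b (free_gen A t) = b t.
Proof.
rewrite /free_lift /= (@free_lift_widen _ _ _ b _ [fset t]%fset).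
  by rewrite big_seq_fset1 /coeff fsfunE in_fset1 eqxx scale1r.
by apply: finsupp_sub.
Qed.

(** The generators span: each [u] is the sum of its coefficients times generators, checked
    coefficientwise. *)
Lemma linear_free_lift (A : pzRingType) (T : choiceType) (X : lmodType A)
  (f : {linear free_mod A T -> X}) :
  f =1 free_lift (fun t => f (free_gen A t)).
Proof.
move=> u; rewrite /free_lift /= /free_lift_fun.
under eq_bigr do rewrite -linearZ.
rewrite -linear_sum; congr (f _); apply/fsfunP => x.
have coeff_sum (s : seq T) (F : T -> free_mod A T) :
    coeff (\sum_(t <- s) F t) x = \sum_(t <- s) coeff (F t) x.
  apply: (big_morph (fun v => coeff v x)) => [v w|].
    by rewrite -{1}[v]scale1r coeffP mul1r.
  by rewrite /coeff fsfunE.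
have coeffZ a (v : free_mod A T) : coeff (a *: v) x = a * coeff v x.
  by rewrite /coeff free_scaleE.
transitivity (coeff (\sum_(t <- supp u)
    coeff u t *: free_gen A t) x) => //.
rewrite coeff_sum.
under eq_bigr do rewrite coeffZ {2}/coeff fsfunE in_fset1.
have [ux|/[dup] ux /fsfun_dflt->] := boolP (x \in finsupp u).
  rewrite (big_fsetD1 x) //= eqxx mulr1 big1_seq ?addr0 // => t /andP[_].
  by rewrite in_fsetD1 eq_sym => /andP[/negPf-> _]; rewrite mulr0.
rewrite big1_seq // => t /andP[_ ut].
by case: eqP => [e|]; rewrite ?mulr0 //; move: ux; rewrite e ut.
Qed.

Lemma projective_free (A : pzRingType) (T : choiceType) :
  projective (free_mod A T).
Proof.
move=> X Y g f g_surj.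
have /choice[s sP] : forall y, exists x, g x = y by [].
exists (free_lift (fun t => s (f (free_gen A t)))) => u /=.
rewrite (linear_free_lift f) /= /free_lift_fun linear_sum.
by apply: eq_bigr => t _; rewrite linearZ /= sP.
Qed.

(** * Tools for constructions degree by degree *)

(** Dependent choice for components of chain maps and homotopies, whose type varies with the degree.
    [P] is the invariant that makes the next choice possible. *)
Lemma dependent_sequence (T : nat -> Type) (P : forall n, T n -> Prop)
    (R : forall n, T n -> T n.+1 -> Prop) (x0 : T 0%N) :
  P 0%N x0 -> (forall n x, P n x -> exists2 y, P n.+1 y & R n x y) ->
  exists2 u : forall n, T n, u 0%N = x0 & forall n, R n (u n) (u n.+1).
Proof.
move=> Px0 step.
pose next n (s : {x : T n | P n x}) :
    {y : T n.+1 | P n.+1 y /\ R n (sval s) y} :=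
  cid (let: ex_intro2 y Py Ry := step n _ (svalP s) in
       ex_intro _ y (conj Py Ry)).
pose fix u n : {x : T n | P n x} :=
  if n is m.+1 then exist _ (sval (next m (u m))) (svalP (next m (u m))).1
  else exist _ x0 Px0.
exists (fun n => sval (u n)) => // n.
exact: (svalP (next n (u n))).2.
Qed.

(** Both [f] and [u] factor through [ker g], and exactness makes the factor of [f] surjective. *)
Lemma projective_lift_exact (A : pzRingType) (Q X Y Z : lmodType A)
    (f : {linear X -> Y}) (g : {linear Y -> Z}) (u : {linear Q -> Y}) :
  projective Q -> exact_at f g -> (forall q, g (u q) = 0) ->
  exists v : {linear Q -> X}, forall q, f (v q) = u q.
Proof.
move=> Qproj fg gu0; have [i_inj i_ex] := ker_inclP g.
have [q qE] := factor_injective i_inj (fun x => (i_ex (u x)).1 (gu0 x)).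
have fk x : exists y, ker_incl g y = f x.
  by apply/i_ex/fg; exists x.
have [p pE] := factor_injective i_inj fk.
have p_surj : surjective p.
  move=> y; have [|x fx] := (fg (ker_incl g y)).1.
    by apply/i_ex; exists y.
  by exists x; apply: i_inj; rewrite pE.
have [v vE] := Qproj _ _ p q p_surj.
by exists v => x; rewrite -pE -qE; congr (ker_incl g _); apply: vE.
Qed.

(** * The canonical free resolution *)

Definition cover (A : pzRingType) (X : lmodType A) :
  {linear free_mod A X -> X} := free_lift id.

Arguments cover : simpl never.

Lemma cover_surj (A : pzRingType) (X : lmodType A) : surjective (cover X).
Proof. by move=> x; exists (free_gen A x); apply: free_lift_gen. Qed.

(** As [cover] is a function of the module, the resolution is defined by recursion, without
    choices. *)
Fixpoint syzygy (A : pzRingType) (M : lmodType A) (n : nat) : lmodType A :=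
  if n is m.+1 then ker (cover (syzygy M m)) else M.

Arguments syzygy : simpl never.

Definition syzygy_incl (A : pzRingType) (M : lmodType A) (n : nat) :
  {linear syzygy M n.+1 -> free_mod A (syzygy M n)} :=
  ker_incl (cover (syzygy M n)).

Arguments syzygy_incl : simpl never.

(** [Negz n] is degree -(n+1), so it carries the cover of syzygy [n.+1]; ['rV[A]_0] is the zero
    module in positive degrees. *)
Definition res_ob (A : pzRingType) (M : lmodType A) (i : int) : lmodType A :=
  match i with
  | Posz 0 => free_mod A (syzygy M 0)
  | Posz _.+1 => 'rV[A]_0
  | Negz n => free_mod A (syzygy M n.+1)
  end.

(* [Negz 0] and [Negz n.+1] are separated because [succz] only reduces on
   constructors. *)
Definition res_d (A : pzRingType) (M : lmodType A) (i : int) :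
    {linear res_ob M i -> res_ob M (succz i)} :=
  match i with
  | Posz _ => \0
  | Negz 0 => syzygy_incl M 0 \o cover (syzygy M 1)
  | Negz n.+1 => syzygy_incl M n.+1 \o cover (syzygy M n.+2)
  end.

Lemma cover_syzygy (A : pzRingType) (M : lmodType A) n x :
  cover (syzygy M n) (syzygy_incl M n x) = 0.
Proof. by have [_ e] := ker_inclP (cover (syzygy M n)); apply/e; exists x. Qed.

Lemma res_dd (A : pzRingType) (M : lmodType A) i x :
  res_d M (succz i) (res_d M i x) = 0.
Proof.
case: i x => [n|[|[|n]]] x; [by []|by []| |].
- exact: etrans (congr1 (syzygy_incl M 0) (cover_syzygy _)) (linear0 _).
- exact: etrans (congr1 (syzygy_incl M n.+1) (cover_syzygy _)) (linear0 _).
Qed.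

Definition res (A : pzRingType) (M : lmodType A) : complex A :=
  Complex (@res_dd A M).

Lemma projective_zero (A : pzRingType) : projective 'rV[A]_0.
Proof.
move=> X Y g f g_surj; exists \0 => x /=.
by rewrite [x]thinmx0 !raddf0.
Qed.

Lemma res_projective (A : pzRingType) (M : lmodType A) :
  projective_terms (res M).
Proof.
case=> [[|n]|n] /=; [exact: projective_free|exact: projective_zero|].
exact: projective_free.
Qed.

Lemma exact_at_cover (A : pzRingType) (M : lmodType A) n :
  exact_at (syzygy_incl M n \o cover (syzygy M n.+1)) (cover (syzygy M n)).
Proof.
move=> y; have [_ e] := ker_inclP (cover (syzygy M n)).
split=> [/e[z <-]|[x <-]]; last exact: cover_syzygy.
by have [x <-] := cover_surj z; exists x.
Qed.

Lemma exact_at_comp_injective (A : pzRingType) (X Y Z T : lmodType A)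
    (f : {linear X -> Y}) (g : {linear Y -> Z}) (k : {linear Z -> T}) :
  injective k -> exact_at f g -> exact_at f (k \o g).
Proof.
move=> k_inj fg y; split=> [/= kgy0|/fg gy0]; last by rewrite /= gy0 linear0.
by apply/fg/k_inj; rewrite kgy0 linear0.
Qed.

Lemma res_exact (A : pzRingType) (M : lmodType A) n :
  exact_at (cd (res M) (Negz n.+1)) (cd (res M) (Negz n)).
Proof.
have [i_inj _] := ker_inclP (cover (syzygy M n)).
by case: n i_inj => [|n] i_inj;
  apply: (exact_at_comp_injective i_inj); apply: exact_at_cover.
Qed.

Lemma res_exact0 (A : pzRingType) (M : lmodType A) :
  exact_at (cd (res M) (Negz 0)) (cover M : {linear res M (Posz 0) -> M}).
Proof. exact: (@exact_at_cover A M 0). Qed.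

(** * Extending chain maps to the left *)

(** The invariant is that [v] composed with the incoming differential of [X] lands in the cycles of
    [Y]; these are boundaries, so projectivity gives the next component. *)
Lemma lift_left (A : pzRingType) (X Y : complex A)
    (f0 : {linear X (Posz 0) -> Y (Posz 0)})
    (v0 : {linear X (Negz 0) -> Y (Negz 0)}) :
  (forall n, projective (X (Negz n))) ->
  (forall n, exact_at (cd Y (Negz n.+1)) (cd Y (Negz n))) ->
  (forall x, cd Y (Negz 0) (v0 x) = f0 (cd X (Negz 0) x)) ->
  exists2 v : forall n, {linear X (Negz n) -> Y (Negz n)}, v 0%N = v0 &
    forall n x, cd Y (Negz n.+1) (v n.+1 x) = v n (cd X (Negz n.+1) x).
Proof.
move=> Xproj Yex v0E.
apply: (@dependent_sequence (fun n => {linear X (Negz n) -> Y (Negz n)})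
  (fun n v => forall x, cd Y (Negz n) (v (cd X (Negz n.+1) x)) = 0)
  (fun n v w => forall x, cd Y (Negz n.+1) (w x) = v (cd X (Negz n.+1) x))).
  move=> x; rewrite v0E.
  have -> : cd X (Negz 0) (cd X (Negz 1) x) = 0 := cdd x.
  exact: linear0.
move=> n v dvd.
have [w wE] := projective_lift_exact (Xproj n.+1) (Yex n) 
  (dvd : forall q, cd Y (Negz n) ((v \o cd X (Negz n.+1)) q) = 0).
exists w => // x; rewrite wE /=.
have -> : cd X (Negz n.+1) (cd X (Negz n.+2) x) = 0 := cdd x.
exact: linear0.
Qed.

(** * The counit of the adjunction *)

Lemma chain_zero_subproof (A : pzRingType) (X Y : complex A) i x :
  (\0 : {linear X (succz i) -> Y (succz i)}) (cd X i x) =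
  cd Y i ((\0 : {linear X i -> Y i}) x).
Proof. by rewrite /= raddf0. Qed.

Definition chain_zero (A : pzRingType) (X Y : complex A) : chain_map X Y :=
  ChainMap (@chain_zero_subproof A X Y).

Lemma homotopic_sym (A : pzRingType) (X Y : complex A) (f g : chain_map X Y) :
  homotopic f g -> homotopic g f.
Proof. by have [_ s _] := homotopic_equiv X Y; apply: s. Qed.

Lemma homotopic_trans (A : pzRingType) (X Y : complex A)
  (f g h : chain_map X Y) : homotopic f g -> homotopic g h -> homotopic f h.
Proof. by have [_ _ t] := homotopic_equiv X Y; apply: t. Qed.

(** Composition with the counit is inverse, up to homotopy, to [adjr]. Injectivity is recorded only
    at the zero map. *)
Lemma counit_universal (A : pzRingType) (P : complex A) :
  has_right_adjoint (e_star A) -> projective_terms P ->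
  exists (E : complex A) (eps : chain_map E P), [/\ in_E E,
    forall (X : complex A) (f : chain_map X P), in_E X ->
      exists h : chain_map X E, homotopic (chain_comp eps h) f
    & forall (X : complex A) (h : chain_map X E), in_E X ->
      homotopic (chain_comp eps h) (chain_zero X P) ->
      homotopic h (chain_zero X E)].
Proof.
move=> [G [adj]] Pproj; pose y : obj (K_Pro A) := exist _ P Pproj.
pose E := sval (sval (fobj G y)).
pose adjr (x : obj (E_cat A)) (f : chain_map (sval (sval x)) P) :
  chain_map (sval (sval x)) E := @adj_r _ _ _ _ adj x y f.
pose adjl (x : obj (E_cat A)) (f : chain_map (sval (sval x)) E) :
  chain_map (sval (sval x)) P := @adj_l _ _ _ _ adj x y f.
have adjr_homotopic x (f f' : chain_map (sval (sval x)) P) :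
  homotopic f f' -> homotopic (adjr x f) (adjr x f').
  exact: (@adj_r_heq _ _ _ _ adj x y).
have adjl_homotopic x (f f' : chain_map (sval (sval x)) E) :
  homotopic f f' -> homotopic (adjl x f) (adjl x f').
  exact: (@adj_l_heq _ _ _ _ adj x y).
have adjrK x (f : chain_map (sval (sval x)) P) :
  homotopic (adjl x (adjr x f)) f.
  exact: (@adj_rK _ _ _ _ adj x y).
pose eps : chain_map E P := adjl (fobj G y) (chain_id E).
have adjr_eps x (k : chain_map (sval (sval x)) E) :
    homotopic (adjr x (chain_comp eps k)) k.
  (* Naturality of [adj_r] in the source; the identity of [P] is inserted because [adj_natural]
     treats both variables at once. *)
  have nat : homotopic
      (adjr x (chain_comp (chain_id P) (chain_comp eps k)))
      (chain_comp (fmap G (idm y)) (chain_comp (adjr (fobj G y) eps) k)).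
    exact: (@adj_natural _ _ _ _ adj (fobj G y) x y y k (idm y) eps).
  have id1 : homotopic (fmap G (idm y) : chain_map E E) (chain_id E).
    exact: (fmap_id G y).
  have id2 : homotopic (adjr (fobj G y) eps) (chain_id E).
    exact: (@adj_lK _ _ _ _ adj (fobj G y) y).
  apply: homotopic_trans (homotopic_trans nat _).
    by apply: adjr_homotopic; apply: homotopic_eq.
  have kk : homotopic k k by apply: homotopic_eq.
  apply: homotopic_trans (homotopic_comp id1 (homotopic_comp id2 kk)) _.
  exact: homotopic_eq.
(* Objects of [E_cat] are complexes with proofs; destructing the equality turns maps from [X] into
   maps from the packaged object. *)
have toK X : in_E X -> {x : obj (E_cat A) | sval (sval x) = X}.
  by move=> XE; have [Xp _ _] := XE; exists (exist _ (exist _ X Xp) XE).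
exists E, eps; split.
- exact: (svalP (fobj G y)).
- move=> X f /toK[x xX]; case: _ / xX f => f; exists (adjr x f).
  apply: homotopic_trans (adjrK x f).
  apply: homotopic_trans (homotopic_sym (adjrK x _)) _.
  exact/adjl_homotopic/adjr_eps.
- move=> X h /toK[x xX]; case: _ / xX h => h h0.
  apply: homotopic_trans (homotopic_sym (adjr_eps x h)) _.
  apply: homotopic_trans (adjr_eps x (chain_zero _ E)).
  apply/adjr_homotopic/(homotopic_trans h0)/homotopic_eq => i z.
  by rewrite /= raddf0.
Qed.

(** * Comparison theorems for the free resolution *)

Definition glue (T : int -> Type) (f : forall n, T (Posz n))
    (v : forall n, T (Negz n)) (i : int) : T i :=
  match i with Posz n => f n | Negz n => v n end.

Lemma glue_chain_map (A : pzRingType) (X Y : complex A)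
    (f : forall n, {linear X (Posz n) -> Y (Posz n)})
    (v : forall n, {linear X (Negz n) -> Y (Negz n)}) :
  (forall n x, cd Y (Posz n) (f n x) = f n.+1 (cd X (Posz n) x)) ->
  (forall x, cd Y (Negz 0) (v 0%N x) = f 0%N (cd X (Negz 0) x)) ->
  (forall n x, cd Y (Negz n.+1) (v n.+1 x) = v n (cd X (Negz n.+1) x)) ->
  exists h : chain_map X Y, forall n, h (Posz n) = f n.
Proof.
move=> fP v0P vP.
pose c i : {linear X i -> Y i} :=
  @glue (fun i => {linear X i -> Y i}) f v i.
have cP i x : c (succz i) (cd X i x) = cd Y i (c i x).
  by case: i x => [n|[|n]] x /=; rewrite ?fP ?v0P ?vP.
by exists (ChainMap cP).
Qed.

(** [X] may be nonzero in positive degrees: there the target vanishes, so the lift is zero. *)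
Lemma resolution_lift (A : pzRingType) (X : complex A) (M : lmodType A)
    (u : {linear X (Posz 0) -> M}) :
  projective_terms X -> (forall x, u (cd X (Negz 0) x) = 0) ->
  exists f : chain_map X (res M), forall x, cover M (f (Posz 0) x) = u x.
Proof.
move=> Xproj ud.
have [f0 f0E] := Xproj (Posz 0) _ _ (cover M) u (@cover_surj A M).
have f0d x : cover M ((f0 \o cd X (Negz 0)) x) = 0.
  by rewrite -[RHS](ud x) -f0E.
have [v0 v0E] := projective_lift_exact (Xproj (Negz 0)) (@res_exact0 A M) f0d.
have [v vE vP] := @lift_left A X (res M) f0 v0 (fun n => Xproj _)
  (@res_exact A M) v0E.
pose f n : {linear X (Posz n) -> res M (Posz n)} :=
  match n with 0%N => f0 | m.+1 => \0 end.
have [||//|h hP] := @glue_chain_map A X (res M) f v.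
- by [].
- by move=> x; rewrite vE; apply: v0E.
- by exists h => x; rewrite hP; apply: f0E.
Qed.

(** The map [b] serves as the homotopy component from X^1. By hypothesis [f] minus [b] after the
    differential has values in boundaries in degree 0, which starts the homotopy to the left. *)
Lemma resolution_null_homotopic (A : pzRingType) (X : complex A)
    (M : lmodType A) (f : chain_map X (res M))
    (b : {linear X (Posz 1) -> res M (Posz 0)}) :
  projective_terms X ->
  (forall x, cover M (f (Posz 0) x) = cover M (b (cd X (Posz 0) x))) ->
  homotopic f (chain_zero X (res M)).
Proof.
move=> Xproj fb.
have fb0 x : cover M ((f (Posz 0) \- (b \o cd X (Posz 0))) x) = 0.
  by rewrite /= raddfB /= -fb subrr.
have [t0 t0E] := projective_lift_exact (Xproj (Posz 0)) (@res_exact0 A M) fb0.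
(* [T n] holds the component from degree -n to degree -(n+1). [P] says that the remaining error of
   [f] is a cycle, and [R] that the next component bounds it. *)
pose T n := {linear X (succz (Negz n)) -> res M (Negz n)}.
pose P n (t : T n) := forall x : X (Negz n),
  cd (res M) (Negz n) (f (Negz n) x - t (cd X (Negz n) x)) = 0.
pose R n (t : T n) (t' : T n.+1) := forall x : X (Negz n),
  cd (res M) (Negz n.+1) (t' x) = f (Negz n) x - t (cd X (Negz n) x).
have [||t t0' tR] := @dependent_sequence T P R t0.
- move=> x; apply: etrans (raddfB _ _ _) _.
  apply/eqP; rewrite subr_eq0; apply/eqP; apply: etrans (esym (cmapd f x)) _.
  apply: esym; apply: etrans (t0E _) _ => /=.
  have -> : cd X (Posz 0) (cd X (Negz 0) x) = 0 := cdd x.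
  by apply: etrans (subr0 _); congr (_ - _); apply: raddf0.
- move=> n t tP.
  have [t' t'E] := projective_lift_exact (Xproj (Negz n)) (@res_exact A M n)
    (tP : forall x, cd (res M) (Negz n)
       ((f (Negz n) \- (t \o cd X (Negz n))) x) = 0).
  exists t' => // x.
  apply: etrans (raddfB _ _ _) _.
  apply/eqP; rewrite subr_eq0; apply/eqP; apply: etrans (esym (cmapd f x)) _.
  apply: esym; apply: etrans (t'E _) _ => /=.
  have -> : cd X (Negz n) (cd X (Negz n.+1) x) = 0 := cdd x.
  by apply: etrans (subr0 _); congr (_ - _); apply: raddf0.
pose s n : {linear X (succz (Posz n)) -> res M (Posz n)} :=
  match n with 0%N => b | m.+1 => \0 end.
exists (@glue (fun i => {linear X (succz i) -> res M i}) s t).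
case=> [n|[|n]] x /=; rewrite subr0.
- by rewrite [LHS]thinmx0 [RHS]thinmx0.
- rewrite t0'; apply: esym.
  exact: etrans (congr1 (+%R^~ (b (cd X (Posz 0) x))) (t0E x)) (subrK _ _).
- apply: esym.
  exact: etrans (congr1 (+%R^~ (t n (cd X (Negz n) x))) (tR n x)) (subrK _ _).
Qed.

(** * Direct sums, and projectives as Gorenstein projectives *)

Definition pairing (A : pzRingType) (X Y Z : lmodType A)
    (f : {linear X -> Y}) (g : {linear X -> Z}) (x : X) : (Y * Z)%type :=
  (f x, g x).

Lemma pairing_linear (A : pzRingType) (X Y Z : lmodType A)
  (f : {linear X -> Y}) (g : {linear X -> Z}) : linear (pairing f g).
Proof. by move=> a x y; rewrite /pairing !linearP. Qed.

HB.instance Definition _ (A : pzRingType) (X Y Z : lmodType A)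
    (f : {linear X -> Y}) (g : {linear X -> Z}) :=
  GRing.isLinear.Build A X (Y * Z)%type _ (pairing f g) (pairing_linear f g).

Lemma linear_pair (A : pzRingType) (X Y Z : lmodType A)
    (f : {linear (X * Y)%type -> Z}) x y :
  f (x, y) = f (x, 0) + f (0, y).
Proof.
rewrite -raddfD; congr (f _).
by apply: (congr2 pair); rewrite /= ?addr0 ?add0r.
Qed.

Lemma projective_pair (A : pzRingType) (P Q : lmodType A) :
  projective P -> projective Q -> projective (P * Q)%type.
Proof.
move=> Pproj Qproj X Y g f g_surj.
have [h hE] := Pproj _ _ g (f \o pairing idfun \0) g_surj.
have [h' h'E] := Qproj _ _ g (f \o pairing \0 idfun) g_surj.
exists ((h \o fst) \+ (h' \o snd)) => -[p q].
by rewrite [RHS]linear_pair -[f (p, 0)]hE -[f (0, q)]h'E /= raddfD.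
Qed.

(** The converse implication follows from [cdd]. *)
Lemma Hom_exactI (A : pzRingType) (X : complex A) (Q : lmodType A) :
  (forall i (f : {linear X (succz i) -> Q}), f \o cd X i =1 \0 ->
    exists g : {linear X (succz (succz i)) -> Q}, g \o cd X (succz i) =1 f) ->
  Hom_exact X Q.
Proof.
move=> ex i f; split=> [/ex //|[g gE] x].
by rewrite /= -gE /= cdd raddf0.
Qed.

Lemma pair_complex_dd (A : pzRingType) (X Y : complex A) i
    (x : (X i * Y i)%type) :
  pairing (cd X (succz i) \o fst) (cd Y (succz i) \o snd)
    (pairing (cd X i \o fst) (cd Y i \o snd) x) = 0.
Proof. by rewrite /pairing /= !cdd. Qed.

Definition pair_complex (A : pzRingType) (X Y : complex A) : complex A :=
  @Complex A (fun i => (X i * Y i)%type)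
    (fun i => pairing (cd X i \o fst) (cd Y i \o snd))
    (@pair_complex_dd A X Y).

Lemma in_E_pair (A : pzRingType) (X Y : complex A) :
  in_E X -> in_E Y -> in_E (pair_complex X Y).
Proof.
move=> [Xp Xe Xh] [Yp Ye Yh]; split.
- by move=> i; apply: projective_pair.
- move=> i [x y]; split.
    move=> [/Xe[x' <-] /Ye[y' <-]]; by exists (x', y').
  by move=> [[x' y'] [<- <-]]; apply: (congr2 pair); rewrite /= cdd.
- move=> Q Qp; apply: Hom_exactI => i f fd.
  have [|g gE] := (Xh Q Qp i (f \o pairing idfun \0)).1.
    move=> x /=; apply: etrans (fd (x, 0)); congr (f _).
    by apply: (congr2 pair) => //=; rewrite raddf0.
  have [|h hE] := (Yh Q Qp i (f \o pairing \0 idfun)).1.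
    move=> x /=; apply: etrans (fd (0, x)); congr (f _).
    by apply: (congr2 pair) => //=; rewrite raddf0.
  exists ((g \o fst) \+ (h \o snd)) => -[x y].
  by rewrite [RHS]linear_pair -[f (x, 0)]gE -[f (0, y)]hE.
Qed.

Lemma gorenstein_projective_pair (A : pzRingType) (G H : lmodType A) :
  gorenstein_projective G -> gorenstein_projective H ->
  gorenstein_projective (G * H)%type.
Proof.
move=> [X XE [k [k_inj kX]]] [Y YE [l [l_inj lY]]].
exists (pair_complex X Y); first exact: in_E_pair.
exists (pairing (k \o fst) (l \o snd)); split.
  by move=> [x y] [x' y'] [/k_inj -> /l_inj ->].
move=> [x y]; split.
  by move=> [/kX[x' <-] /lY[y' <-]]; exists (x', y').
move=> [[x' y'] [<- <-]]; apply: (congr2 pair) => /=.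
  by apply/kX; exists x'.
by apply/lY; exists y'.
Qed.

Lemma contractible_dd (A : pzRingType) (P : lmodType A) (x : (P * P)%type) :
  pairing snd \0 (pairing (snd : {linear (P * P)%type -> P}) \0 x) = 0
    :> (P * P)%type.
Proof. by []. Qed.

(** The sum of all shifts of the identity complex of [P]: each differential sends (x, y) to (y, 0),
    so the cycles are the first copy of [P]. *)
Definition contractible (A : pzRingType) (P : lmodType A) : complex A :=
  @Complex A (fun=> (P * P)%type) (fun=> pairing snd \0)
    (fun=> @contractible_dd A P).

Lemma gorenstein_projective_projective (A : pzRingType) (P : lmodType A) :
  projective P -> gorenstein_projective P.
Proof.
move=> Pproj; exists (contractible P).
  split=> [i|i|Q _]; first exact: projective_pair.
    move=> [x y]; split=> [[/= ->]|[[a b] /= [_ <-]] //].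
    by exists (0, x).
  apply: Hom_exactI => i f fd.
  (* A cocycle [f] vanishes on the first summand, so f(x, y) = f(0, y), which depends only on the
     differential (y, 0). *)
  exists (f \o pairing \0 fst) => -[x y] /=.
  have fx0 : f (x, 0) = 0 := fd (0, x).
  by rewrite [RHS]linear_pair fx0 add0r.
exists (pairing idfun \0); split=> [x y [] //|[x y]].
split=> [[/= ->]|[z [_ <-]] //]; by exists x.
Qed.

(** * Cycles of complexes in E(A) and maps out of them *)

(** Moves Z^2(X) to the position where [gorenstein_projective] reads off cycles. The usual sign is
    omitted, as kernels and images do not see it. *)
Definition shift (A : pzRingType) (X : complex A) : complex A :=
  @Complex A (fun i => X (succz i)) (fun i => cd X (succz i))
    (fun i => @cdd A X (succz i)).

Lemma in_E_shift (A : pzRingType) (X : complex A) : in_E X -> in_E (shift X).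
Proof.
move=> [Xp Xe Xh]; split=> [i|i|Q Qp i]; [exact: Xp|exact: Xe|].
exact: (Xh Q Qp (succz i)).
Qed.

Lemma cycles_cover (A : pzRingType) (X : complex A) (G : lmodType A)
    (k : {linear G -> X (Posz 1)}) :
  exact_complex X -> is_kernel k (cd X (Posz 1)) ->
  exists2 p : {linear X (Posz 0) -> G}, surjective p &
    forall x, k (p x) = cd X (Posz 0) x.
Proof.
move=> Xe [k_inj kX].
have kd x : exists z, k z = cd X (Posz 0) x by apply/kX; exact: (cdd x).
have [p pE] := factor_injective k_inj kd; exists p => // z.
have [|x xE] := (Xe (Posz 0) (k z)).1; first by apply/kX; exists z.
by exists x; apply: k_inj; rewrite pE.
Qed.

Lemma cycles_cover_boundary (A : pzRingType) (X : complex A) (G : lmodType A)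
    (k : {linear G -> X (Posz 1)}) (p : {linear X (Posz 0) -> G}) :
  injective k -> (forall x, k (p x) = cd X (Posz 0) x) ->
  forall x, p (cd X (Negz 0) x) = 0.
Proof.
move=> k_inj pE x; apply: k_inj.
by apply: etrans (pE _) (etrans _ (esym (raddf0 k))); exact: (cdd x).
Qed.

(** Pulled back along X^0 -> Z^1(X), [u] becomes a cocycle of Hom(X, Q), hence factors through the
    differential X^0 -> X^1. *)
Lemma extend_to_projective (A : pzRingType) (X : complex A) (G Q : lmodType A)
    (k : {linear G -> X (Posz 1)}) (u : {linear G -> Q}) :
  in_E X -> is_kernel k (cd X (Posz 1)) -> projective Q ->
  exists w : {linear X (Posz 1) -> Q}, forall z, w (k z) = u z.
Proof.
move=> [Xp Xe Xh] kX Qp; have [p p_surj pE] := cycles_cover Xe kX.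
have [|w wE] := (Xh Q Qp (Negz 0) (u \o p)).1.
  by move=> x; rewrite /= (cycles_cover_boundary kX.1 pE) raddf0.
by exists w => z; have [x <-] := p_surj z; rewrite pE; apply: wE.
Qed.

(** To the left, [X] is projective and [Y] exact; to the right, Hom from [X] into the projective
    terms of [Y] is exact. *)
Lemma chain_map_extending (A : pzRingType) (X Y : complex A)
    (w : {linear X (Posz 1) -> Y (Posz 1)}) :
  in_E X -> in_E Y ->
  (forall x, cd Y (Posz 1) (w (cd X (Posz 0) x)) = 0) ->
  exists h : chain_map X Y, h (Posz 1) = w.
Proof.
move=> [Xp _ Xh] [Yp Ye _] dwd.
have [f0 f0E] := projective_lift_exact (Xp (Posz 0)) (Ye (Posz 0))
  (dwd : forall x, cd Y (Posz 1) ((w \o cd X (Posz 0)) x) = 0).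
have df0d x : cd Y (Posz 0) ((f0 \o cd X (Negz 0)) x) = 0.
  apply: etrans (f0E _) _ => /=.
  have -> : cd X (Posz 0) (cd X (Negz 0) x) = 0 := cdd x.
  exact: raddf0.
have [v0 v0E] := projective_lift_exact (Xp (Negz 0)) (Ye (Negz 0)) df0d.
have [v vE vP] := @lift_left A X Y f0 v0 (fun n => Xp _)
  (fun n => Ye (Negz n.+1)) v0E.
(* Index n stands for degree n+1, so that the sequence starts at [w]. *)
pose T n := {linear X (Posz n.+1) -> Y (Posz n.+1)}.
pose P n (t : T n) := forall x, cd Y (Posz n.+1) (t (cd X (Posz n) x)) = 0.
pose R n (t : T n) (t' : T n.+1) :=
  forall x, t' (cd X (Posz n.+1) x) = cd Y (Posz n.+1) (t x).
have [||t t0 tR] := @dependent_sequence T P R w; first exact: dwd.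
  move=> n t tP.
  have [t' t'E] := (Xh _ (Yp (Posz n.+2)) (Posz n)
    (cd Y (Posz n.+1) \o t)).1 tP.
  exists t' => // x; apply: etrans (congr1 _ (t'E x)) _.
  exact: (cdd (t x)).
pose f n : {linear X (Posz n) -> Y (Posz n)} :=
  match n with 0%N => f0 | m.+1 => t m end.
have [|||h hP] := @glue_chain_map A X Y f v; last by exists h; rewrite hP.
- case=> [|n] x; last by rewrite /= tR.
  by rewrite /= t0; apply: f0E.
- by move=> x; rewrite vE; apply: v0E.
- exact: vP.
Qed.

(* Vanishing of [Ext^1(G, Z)] for all Gorenstein projective
   [G]: as [X^1] is projective and [Z^2(X) = X^1 / Z^1(X)], [Ext^1(Z^2(X), Z)]
   is the cokernel of [Hom(X^1, Z) -> Hom(Z^1(X), Z)]. *)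
Definition extends_from_cycles (A : pzRingType) (Z : lmodType A) : Prop :=
  forall (X : complex A) (G : lmodType A) (k : {linear G -> X (Posz 1)})
      (u : {linear G -> Z}),
    in_E X -> is_kernel k (cd X (Posz 1)) ->
    exists w : {linear X (Posz 1) -> Z}, forall z, w (k z) = u z.

(** * Consequences of Ext vanishing for syzygies and resolutions *)

(** Extend the map to X^1, lift it through [s] by projectivity of X^1, and restrict to the
    cycles. *)
Lemma relative_epi_of_extends (A : pzRingType) (Q Z : lmodType A)
    (s : {linear Q -> Z}) :
  surjective s -> extends_from_cycles Z -> gp_relative_epi s.
Proof.
move=> s_surj Zext G u [X XE [k kX]]; have [Xp _ _] := XE.
have [w wE] := Zext X G k u XE kX.
have [v vE] := Xp _ _ _ s w s_surj.
by exists (v \o k) => z; rewrite /= -wE; apply: vE.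
Qed.

(** The correction argument: [g \o w] kills Z^1(X), so it induces a map Z^2(X) -> M. Lifting this
    through [g] and subtracting it from [w] gives values in Z without changing [w] on Z^1(X). *)
Lemma extends_kernel (A : pzRingType) (Z G M : lmodType A)
    (k : {linear Z -> G}) (g : {linear G -> M}) :
  is_kernel k g -> gp_relative_epi g ->
  (forall (X : complex A) (H : lmodType A) (l : {linear H -> X (Posz 1)})
      (u : {linear H -> Z}), in_E X -> is_kernel l (cd X (Posz 1)) ->
    exists w : {linear X (Posz 1) -> G}, forall z, w (l z) = k (u z)) ->
  extends_from_cycles Z.
Proof.
move=> [k_inj kg] g_epi ext X H l u XE lX; have [w wE] := ext X H l u XE lX.
(* This kernel is Z^2(X), and [q] below is the surjection of X^1 onto it. *)
have [i_inj iX] := ker_inclP (cd (shift X) (Posz 1)).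
have SE := in_E_shift XE; have [_ Se _] := SE.
have [q q_surj qE] := cycles_cover Se (conj i_inj iX).
have [|c cE] := @factor_surjective A _ _ _ q (g \o w) q_surj.
  move=> x qx0; have [|z <-] := (lX.2 x).1.
    by apply: etrans (esym (qE x)) _; rewrite qx0; apply: raddf0.
  by rewrite /= wE; apply/kg; exists (u z).
have [|v vE] := g_epi _ c.
  by exists (shift X) => //; exists (ker_incl (cd (shift X) (Posz 1))).
have gv y : g (v y) = c y := vE y.
have ex x : exists y, k y = (w \- (v \o q)) x.
  by apply/kg; rewrite linearB /= gv cE subrr.
have [w' w'E] := factor_injective k_inj ex.
exists w' => z; apply: k_inj; rewrite w'E /= wE.
have -> : q (l z) = 0.
  apply: i_inj; apply: etrans (qE _) (etrans _ (esym (linear0 _))).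
  by apply/lX.2; exists z.
by rewrite raddf0 subr0.
Qed.

(** Maps into the projective [Q] extend by total acyclicity, and the correction applies since [s] is
    a relative epimorphism. *)
Lemma extends_syzygy (A : pzRingType) (K Q Z : lmodType A)
    (k : {linear K -> Q}) (s : {linear Q -> Z}) :
  projective Q -> surjective s -> is_kernel k s ->
  extends_from_cycles Z -> extends_from_cycles K.
Proof.
move=> Qp s_surj ks Zext.
apply: extends_kernel ks (relative_epi_of_extends s_surj Zext) _.
move=> X H l u XE lX.
exact: (extend_to_projective (k \o u) XE lX Qp).
Qed.

Lemma projective_resolution_gp (A : pzRingType) (Z : lmodType A)
    (R : augmented_resolution Z) :
  extends_from_cycles Z -> projective_resolution R -> gp_resolution R.
Proof.
move=> Zext Rproj.
(* [K] is the image of [rd R n], a syzygy of [Z]; carrying its Ext vanishing along makes the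
   induction work. *)
have step n : exists (K : lmodType A) (s : {linear R n.+1 -> K})
    (k : {linear K -> R n}),
    [/\ surjective s, injective k, k \o s =1 rd R n & extends_from_cycles K].
  elim: n => [|n [K [s [k [s_surj k_inj ks Kext]]]]].
    have [i_inj iE] := ker_inclP (raug R).
    have ex x : exists y, ker_incl (raug R) y = rd R 0 x.
      by apply/iE/raug_exact; exists x.
    have [s sE] := factor_injective i_inj ex.
    exists (ker (raug R)), s, (ker_incl (raug R)); split=> //.
      move=> y; have [|x xE] := (@raug_exact _ _ R (ker_incl _ y)).1.
        by apply/iE; exists y.
      by exists x; apply: i_inj; rewrite sE.
    exact: extends_syzygy (Rproj 0%N) (@raug_surj _ _ R) (conj i_inj iE) Zext.
  have [i_inj iE] := ker_inclP s.
  have ex x : exists y, ker_incl s y = rd R n.+1 x.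
    apply/iE/k_inj; rewrite raddf0 -[LHS]/((k \o s) _) ks.
    by apply/rd_exact; exists x.
  have [t tE] := factor_injective i_inj ex.
  exists (ker s), t, (ker_incl s); split=> //.
    move=> y; have [|x xE] := (@rd_exact _ _ R n (ker_incl _ y)).1.
      rewrite -ks /=; have -> : s (ker_incl s y) = 0 by apply/iE; exists y.
      exact: raddf0.
    by exists x; apply: i_inj; rewrite tE.
  exact: extends_syzygy (Rproj n.+1) s_surj (conj i_inj iE) Kext.
split=> [n||n].
- exact/gorenstein_projective_projective/Rproj.
- exact: relative_epi_of_extends (@raug_surj _ _ R) Zext.
- have [K [s [k [s_surj k_inj ks Kext]]]] := step n.
  by exists K, s, k; split=> //; apply: relative_epi_of_extends.
Qed.

Lemma chain_map_cycles (A : pzRingType) (X Y : complex A) (G H : lmodType A)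
    (k : {linear G -> X (Posz 1)}) (l : {linear H -> Y (Posz 1)})
    (h : chain_map X Y) :
  is_kernel k (cd X (Posz 1)) -> is_kernel l (cd Y (Posz 1)) ->
  exists a : {linear G -> H}, forall z, l (a z) = h (Posz 1) (k z).
Proof.
move=> [_ kX] [l_inj lY].
apply: (factor_injective (f := h (Posz 1) \o k) l_inj) => z.
apply/lY; apply: etrans (esym (cmapd h (k z))) _.
have -> : cd X (Posz 1) (k z) = 0 by apply/kX; exists z.
exact: raddf0.
Qed.

(** * The precover and the theorem *)

Lemma gp_precover_exists (A : pzRingType) (M : lmodType A) :
  has_right_adjoint (e_star A) ->
  exists (G : lmodType A) (g : {linear G -> M}), gp_precover g /\
    forall (Z : lmodType A) (k : {linear Z -> G}),
      is_kernel k g -> extends_from_cycles Z.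
Proof.
move=> /counit_universal/(_ (@res_projective A M)).
move=> [E [eps [EE eps_surj eps_inj]]].
have [Ep Ee _] := EE.
pose i0 := ker_incl (cd E (Posz 1)).
have i0K : is_kernel i0 (cd E (Posz 1)) := ker_inclP _.
have [i0_inj i0E] := i0K.
have [p0 p0_surj p0E] := cycles_cover Ee i0K.
(* [eps] sends boundaries in E^0 to boundaries in P^0, which the augmentation kills, so it induces
   [g0] on Z^1(E). *)
have [|g0 g0E] :=
  @factor_surjective A _ _ _ p0 (cover M \o eps (Posz 0)) p0_surj.
  move=> x px0; have [|y <-] := (Ee (Negz 0) x).1.
    by apply: etrans (esym (p0E x)) _; rewrite px0; exact: raddf0.
  have e : eps (Posz 0) (cd E (Negz 0) y) =
      cd (res M) (Negz 0) (eps (Negz 0) y).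
    exact: (cmapd eps y).
  by apply: etrans (congr1 _ e) _; apply/res_exact0; exists (eps (Negz 0) y).
pose G0 : lmodType A := ker (cd E (Posz 1)).
pose F : lmodType A := free_mod A M.
pose g : {linear (G0 * F)%type -> M} := (g0 \o fst) \+ (cover M \o snd).
have g_epi : gp_relative_epi g.
  move=> H u [X XE [l lX]]; have [Xp Xe _] := XE; have [l_inj _] := lX.
  have [p p_surj pE] := cycles_cover Xe lX.
  have [|f fE] := @resolution_lift A X M (u \o p) Xp.
    by move=> x; rewrite /= (cycles_cover_boundary l_inj pE) raddf0.
  have [h [s sE]] := eps_surj X f XE.
  have [a aE] := chain_map_cycles h lX i0K.
  have apE x : a (p x) = p0 (h (Posz 0) x).
    apply: i0_inj; rewrite p0E aE pE; exact: (cmapd h x).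
  (* The second component cancels the homotopy term that [g0 \o a] picks up; the other term is a
     boundary and dies in [M]. *)
  exists (pairing a (\- (s (Posz 0) \o l))) => z; have [x <-] := p_surj z.
  rewrite /= apE g0E /= pE -[RHS]fE raddfN.
  have e : eps (Posz 0) (h (Posz 0) x) = f (Posz 0) x +
      (cd (res M) (Negz 0) (s (Negz 0) x) + s (Posz 0) (cd X (Posz 0) x)).
    by apply/eqP; rewrite addrC -subr_eq; apply/eqP; exact: (sE (Negz 0) x).
  have c0 : cover M (cd (res M) (Negz 0) (s (Negz 0) x) : res M (Posz 0)) = 0.
    by apply/res_exact0; exists (s (Negz 0) x).
  rewrite e 2!raddfD /=.
  apply: etrans (congr1 (fun y => _ + (y + _) - _) c0) _.
  by rewrite add0r addrK.
exists (G0 * F)%type, g; split.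
  split=> //; apply: gorenstein_projective_pair.
    by exists E => //; exists i0.
  exact/gorenstein_projective_projective/projective_free.
move=> Z k kg; apply: (extends_kernel kg g_epi) => X H l u XE lX.
have [k_inj kgE] := kg; have [Xp Xe _] := XE; have [l_inj lXE] := lX.
have [p p_surj pE] := cycles_cover Xe lX.
have [b bE] := extend_to_projective (snd \o (k \o u)) XE lX
  (@projective_free A M).
(* The E-part of [k \o u], extended to X^1, becomes degree 1 of a chain map X -> E; [b] extends the
   free part. *)
have [c cE] :=
  extend_to_projective (i0 \o (fst \o (k \o u))) XE lX (Ep (Posz 1)).
have [|h hE] := @chain_map_extending A X E c XE EE.
  by move=> x; rewrite -pE cE; apply/i0E; eexists.
have hp x : p0 (h (Posz 0) x) = (k (u (p x))).1.
  apply: i0_inj; rewrite p0E.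
  apply: etrans (esym (cmapd h x)) _.
  by rewrite -[RHS]cE pE -hE.
have [|s sE] := eps_inj X h XE.
  (* Since [k \o u] has values in the kernel of [g], its two parts have opposite images in [M];
     hence the sign of [b]. *)
  apply: (@resolution_null_homotopic A X M _ (\- b)) => // x.
  have := (kgE _).2 (ex_intro _ (u (p x)) erefl).
  rewrite /= -hp g0E /= => /eqP; rewrite addr_eq0 => /eqP ->.
  by rewrite raddfN -pE bE.
(* As [p0] kills boundaries, applying it to the null-homotopy of [h] in degree 0 leaves only the
   term through X^1. *)
exists (pairing (p0 \o s (Posz 0)) b) => z.
have [x <-] := p_surj z.
rewrite [RHS]surjective_pairing; apply: (congr2 pair) => /=; last exact: bE.
rewrite -hp pE; apply: esym.
have e : h (Posz 0) x =
    cd E (Negz 0) (s (Negz 0) x) + s (Posz 0) (cd X (Posz 0) x).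
  by rewrite -[LHS]subr0; exact: (sE (Negz 0) x).
rewrite e raddfD /=; apply: etrans (add0r _); congr (_ + _).
exact: cycles_cover_boundary i0_inj p0E _.
Qed.

Theorem theorem4p6 (A : pzRingType) (M : lmodType A) :
  has_right_adjoint (e_star A) ->
  exists (G : lmodType A) (g : {linear G -> M}),
    gp_precover g /\
    forall (Z : lmodType A) (k : {linear Z -> G}),
      is_kernel k g ->
      forall R : augmented_resolution Z,
        projective_resolution R -> gp_resolution R.
Proof.
move=> /(gp_precover_exists M)[G [g [g_cover Zext]]]; exists G, g; split=> //.
move=> Z k kg R; exact: projective_resolution_gp (Zext Z k kg).
Qed.
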